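(* The functor $\ell^2 \colon \mathbf{PInj} \to \mathbf{Hilb}$ is faithful and essentially surjective on objects (every Hilbert space $H$ is isomorphic in $\mathbf{Hilb}$ to $\ell^2(X)$ for some set $X$). It is not full, but it reflects isomorphisms: if $\ell^2 f$ is invertible, so is $f$.
   Context: $\mathbf{Hilb}$ is the category whose objects are complex Hilbert spaces and whose morphisms are continuous linear functions. $\mathbf{PInj}$ is the category whose objects are sets and whose morphisms $X \to Y$ are partial injections, i.e. partial functions that are injective on their domain of definition, composed as relations. The functor $\ell^2 \colon \mathbf{PInj} \to \mathbf{Hilb}$ sends a set $X$ to $\ell^2(X) = \{\varphi \colon X \to \mathbb{C} \mid \sum_{x\in X} |\varphi(x)|^2 < \infty\}$ with inner product $\langle \varphi | \psi\rangle = \sum_{x \in X} \overline{\varphi(x)}\psi(x)$, and sends a partial injection $f \colon X \to Y$ to the linear map $\ell^2 f \colon \ell^2(X) \to \ell^2(Y)$ with $(\ell^2 f)(\varphi)(y) = \varphi(x)$ if there is a (necessarily unique) $x$ in the domain of definition of $f$ with $f(x) = y$, and $(\ell^2 f)(\varphi)(y) = 0$ otherwise. *)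

(* Defs.v *)
From HB Require Import structures.
From mathcomp Require Import all_boot all_order all_algebra complex finmap.
From mathcomp Require Import all_classical all_reals all_analysis.
From mathcomp Require Import lra.
From mathcomp Require summability.

Set Implicit Arguments.
Unset Strict Implicit.
Unset Printing Implicit Defensive.

Import Order.TTheory GRing.Theory Num.Theory numFieldNormedType.Exports.

Local Open Scope classical_set_scope.
Local Open Scope ring_scope.

Record category := Category {
  obj :> Type;
  hom : obj -> obj -> Type;
  idm : forall a, hom a a;
  mcomp : forall a b c, hom b c -> hom a b -> hom a c;
  mcomp1m : forall a b (f : hom a b), mcomp (idm b) f = f;
  mcompm1 : forall a b (f : hom a b), mcomp f (idm a) = f;
  mcompA : forall a b c d (h : hom c d) (g : hom b c) (f : hom a b),
    mcomp h (mcomp g f) = mcomp (mcomp h g) f }.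

Arguments hom {_} a b.
Arguments idm {_} a.
Arguments mcomp {_ _ _ _} _ _.

Record functor (C D : category) := Functor {
  functor_obj :> C -> D;
  functor_map : forall a b : C, hom a b -> hom (functor_obj a) (functor_obj b);
  functor_map1 : forall a, functor_map (idm a) = idm (functor_obj a);
  functor_mapM : forall (a b c : C) (g : hom b c) (f : hom a b),
    functor_map (mcomp g f) = mcomp (functor_map g) (functor_map f) }.

Arguments functor_map {_ _} F {_ _} f : rename.

Definition is_iso (C : category) (a b : C) (f : hom a b) : Prop :=
  exists g : hom b a, mcomp g f = idm a /\ mcomp f g = idm b.

Definition isomorphic (C : category) (a b : C) : Prop :=
  exists f : hom a b, is_iso f.

Section functor_properties.
Variables (C D : category) (F : functor C D).

Definition is_faithful : Prop :=
  forall (a b : C) (f g : hom a b), functor_map F f = functor_map F g -> f = g.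

Definition is_full : Prop :=
  forall (a b : C) (h : hom (F a) (F b)), exists f : hom a b, functor_map F f = h.

Definition essentially_surjective : Prop :=
  forall d : D, exists c : C, isomorphic d (F c).

Definition reflects_isomorphisms : Prop :=
  forall (a b : C) (f : hom a b), is_iso (functor_map F f) -> is_iso f.

End functor_properties.

Record pinj (X Y : Type) := PInjection {
  pinj_rel :> X -> Y -> Prop;
  pinj_fun : forall x y y', pinj_rel x y -> pinj_rel x y' -> y = y';
  pinj_inj : forall x x' y, pinj_rel x y -> pinj_rel x' y -> x = x' }.

Lemma pinj_ext (X Y : Type) (f g : pinj X Y) :
  (forall x y, f x y <-> g x y) -> f = g.
Proof.
case: f g => [f f1 f2] [g g1 g2] /= fg.
have e : f = g by apply/funext => x; apply/funext => y; apply/propext.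
by case: _ / e in g1 g2 fg *; congr PInjection; exact: Prop_irrelevance.
Qed.

Definition pinj_id (X : Type) : pinj X X.
Proof. by exists (fun x y => x = y) => [x y y' <-|x x' y ->]. Defined.

Definition pinj_comp (X Y Z : Type) (g : pinj Y Z) (f : pinj X Y) : pinj X Z.
Proof.
exists (fun x z => exists y, f x y /\ g y z).
- move=> x z z' [y [xy yz]] [y' [xy' yz']].
  by rewrite -(pinj_fun xy xy') in yz'; exact: pinj_fun yz yz'.
- move=> x x' z [y [xy yz]] [y' [xy' yz']].
  by rewrite -(pinj_inj yz yz') in xy'; exact: pinj_inj xy xy'.
Defined.

Lemma pinj_comp1m X Y (f : pinj X Y) : pinj_comp (pinj_id Y) f = f.
Proof. by apply: pinj_ext => x y; split=> [[_ [? <-]]//|?]; exists y. Qed.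

Lemma pinj_compm1 X Y (f : pinj X Y) : pinj_comp f (pinj_id X) = f.
Proof. by apply: pinj_ext => x y; split=> [[_ [<- ?]]//|?]; exists x. Qed.

Lemma pinj_compA X Y Z W (h : pinj Z W) (g : pinj Y Z) (f : pinj X Y) :
  pinj_comp h (pinj_comp g f) = pinj_comp (pinj_comp h g) f.
Proof.
apply: pinj_ext => x w; split=> [[z [[y [xy yz]] zw]]|[y [xy [z [yz zw]]]]].
  by exists y; split => //; exists z.
by exists z; split => //; exists y.
Qed.

Definition PInj : category :=
  Category pinj_comp1m pinj_compm1 pinj_compA.

(* The inner product is linear in its second argument and conjugate-linear in
   its first; it is required to induce the given norm. *)

HB.mixin Record NormedModule_isPreHilbert (R : realType) V
    of NormedModule R[i] V := {
  inner : V -> V -> R[i];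
  innerDr : forall u v w, inner u (v + w) = inner u v + inner u w;
  innerZr : forall u a v, inner u (a *: v) = a * inner u v;
  inner_conj : forall u v, inner v u = (inner u v)^*%C;
  inner_norm : forall u, inner u u = `|u| ^+ 2 }.

HB.structure Definition PreHilbert (R : realType) :=
  {V of NormedModule R[i] V & NormedModule_isPreHilbert R V}.

#[short(type="hilbertType")]
HB.structure Definition Hilbert (R : realType) :=
  {V of CompleteNormedModule R[i] V & NormedModule_isPreHilbert R V}.

HB.factory Record Lmodule_isPreHilbert (R : realType) V
    of GRing.Lmodule R[i] V := {
  inner : V -> V -> R[i];
  innerDr : forall u v w, inner u (v + w) = inner u v + inner u w;
  innerZr : forall u a v, inner u (a *: v) = a * inner u v;
  inner_conj : forall u v, inner v u = (inner u v)^*%C;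
  inner_ge0 : forall u, 0 <= inner u u;
  inner_eq0 : forall u, inner u u = 0 -> u = 0 }.

HB.builders Context R V of Lmodule_isPreHilbert R V.

Let hnorm (u : V) : R[i] := sqrtC (inner u u).

Let innerZl u a v : inner (a *: u) v = a^*%C * inner u v.
Proof.
by rewrite (inner_conj v (a *: u)) innerZr rmorphM/= -inner_conj.
Qed.

Let innerDl u v w : inner (u + v) w = inner u w + inner v w.
Proof.
by rewrite (inner_conj w (u + v)) innerDr rmorphD/= -!inner_conj.
Qed.

Let sqr_hnorm u : hnorm u ^+ 2 = inner u u.
Proof. by rewrite sqrtCK. Qed.

Let hnorm_ge0 u : 0 <= hnorm u.
Proof. by rewrite sqrtC_ge0 inner_ge0. Qed.

Let hnormZ a u : hnorm (a *: u) = `|a| * hnorm u.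
Proof.
apply/eqP; rewrite -(@eqrXn2 _ 2)// ?mulr_ge0//; apply/eqP.
rewrite exprMn !sqr_hnorm innerZr innerZl mulrA; congr (_ * _).
by rewrite sqr_normc.
Qed.

Let hnorm_eq0 u : hnorm u = 0 -> u = 0.
Proof. by move/eqP; rewrite sqrtC_eq0 => /eqP/inner_eq0. Qed.

Let inner_expand u v a : inner (u + a *: v) (u + a *: v) =
  inner u u + a * inner u v + (a * inner u v)^*%C + `|a| ^+ 2 * inner v v.
Proof.
rewrite innerDr !innerDl !innerZr !innerZl rmorphM/= -inner_conj sqr_normc.
by rewrite -!addrA mulrA; congr (_ + _); rewrite addrCA.
Qed.

Let CauchySchwarz u v : `|inner u v| <= hnorm u * hnorm v.
Proof.
have [->|v0] := eqVneq v 0.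
  have -> : inner u 0 = 0 by rewrite -(scale0r 0) innerZr mul0r.
  by rewrite normr0 mulr_ge0.
have vv0 : 0 < inner v v.
  rewrite lt_neqAle inner_ge0 andbT eq_sym; apply: contra_neq v0.
  exact: inner_eq0.
have vvr : (inner v v)^*%C = inner v v by rewrite -inner_conj.
rewrite -(@ler_pXn2r _ 2) ?nnegrE ?mulr_ge0// exprMn !sqr_hnorm.
set c := inner u v.
have cr : (`|c| ^+ 2)^*%C = `|c| ^+ 2.
  by rewrite sqr_normc [LHS]rmorphM/= conjcK mulrC.
have := inner_ge0 (u + (- (c^*%C / inner v v)) *: v).
rewrite inner_expand -/c.
have e : - (c^*%C / inner v v) * c = - (`|c| ^+ 2 / inner v v).
  by rewrite sqr_normc mulNr [c * _]mulrC mulrAC.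
have -> : (- (c^*%C / inner v v) * c)^*%C = - (`|c| ^+ 2 / inner v v).
  by rewrite e [LHS]rmorphN; congr (- _); rewrite [LHS]rmorphM [X in X * _]cr fmorphV [X in _ / X]vvr.
rewrite e normrN normf_div exprMn exprVn normcJ.
rewrite (@ger0_norm _ (inner v v)) ?inner_ge0//.
have -> : `|c| ^+ 2 * (inner v v ^+ 2)^-1 * inner v v = `|c| ^+ 2 / inner v v.
  by rewrite expr2 invfM !mulrA divfK ?gt_eqF.
by rewrite addrNK subr_ge0 ler_pdivrMr.
Qed.

Let ler_hnormD u v : hnorm (u + v) <= hnorm u + hnorm v.
Proof.
rewrite -(@ler_pXn2r _ 2) ?nnegrE ?addr_ge0// sqrrD !sqr_hnorm.
rewrite -[v in inner (_ + v) (_ + v)]scale1r inner_expand.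
rewrite normr1 expr1n !mul1r lerD2r -addrA lerD2l.
apply: (le_trans _ (ler_wMn2r 2 (CauchySchwarz u v))).
rewrite addcJ mulr_natl ler_wMn2r//.
case: (inner u v) => a b; rewrite normc_def /= lecR.
by rewrite (le_trans (ler_norm a))// -sqrtr_sqr ler_wsqrtr// lerDl sqr_ge0.
Qed.

HB.instance Definition _ := Lmodule_isNormed.Build R[i] V
  ler_hnormD hnormZ hnorm_eq0.

HB.instance Definition _ := NormedModule_isPreHilbert.Build R V
  innerDr innerZr inner_conj (fun u => esym (sqr_hnorm u)).

HB.end.

Record clinear (R : realType) (V W : hilbertType R) := ContinuousLinear {
  cl_fun :> {linear V -> W};
  cl_continuous : continuous cl_fun }.

Lemma clinear_ext (R : realType) (V W : hilbertType R)
  (f g : clinear V W) : (forall v, f v = g v) -> f = g.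
Proof.
case: f g => [[f cf] f1] [[g cg] g1] /= fg.
have e : f = g by apply/funext.
case: _ / e in cg g1 fg *.
have e : cf = cg.
  case: cf {f1} => [[a] [b]]; case: cg {g1} => [[c] [d]].
  by rewrite (Prop_irrelevance a c) (Prop_irrelevance b d).
by case: _ / e in g1 *; congr ContinuousLinear; exact: Prop_irrelevance.
Qed.

Section clinear_category.
Variable R : realType.
Implicit Types U V W : hilbertType R.

Definition clinear_id V : clinear V V :=
  @ContinuousLinear R V V idfun (fun v => @cvg_id _ (nbhs v)).

Definition clinear_comp U V W
    (g : clinear V W) (f : clinear U V) : clinear U W :=
  @ContinuousLinear R U W (g \o f)
    (fun u => continuous_comp (@cl_continuous _ _ _ f u)
      (@cl_continuous _ _ _ g (f u))).

Lemma clinear_comp1m U V (f : clinear U V) :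
  clinear_comp (clinear_id V) f = f.
Proof. exact: clinear_ext. Qed.

Lemma clinear_compm1 U V (f : clinear U V) :
  clinear_comp f (clinear_id U) = f.
Proof. exact: clinear_ext. Qed.

Lemma clinear_compA T U V W (h : clinear V W)
    (g : clinear U V) (f : clinear T U) :
  clinear_comp h (clinear_comp g f) =
  clinear_comp (clinear_comp h g) f.
Proof. exact: clinear_ext. Qed.

Definition Hilb : category :=
  Category clinear_comp1m clinear_compm1 clinear_compA.

End clinear_category.

#[export] Existing Instance summability.totally_filter.

Section sums.
Variables (R : realType) (I : choiceType).
Local Notation partial_sum := summability.partial_sum.
Local Notation totally := summability.totally.

Lemma le_esum_uniq (a : I -> R) (s : seq I) : (forall x, 0 <= a x) -> uniq s ->
  ((\sum_(x <- s) a x)%:E <= \esum_(x in [set: I]) (a x)%:E)%E.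
Proof.
move=> a0 us; apply: esum_ge; exists [set` s].
  by split => //; exact: finite_seq.
by rewrite -sumEFin -fsbig_seq.
Qed.

Lemma esum_le_uniq (a : I -> R) (M : R) :
  (forall s, uniq s -> \sum_(x <- s) a x <= M) ->
  (\esum_(x in [set: I]) (a x)%:E <= M%:E)%E.
Proof.
move=> aM; apply: ge_ereal_sup => /= _ [A [finA _] <-].
by rewrite fsbig_finite//= sumEFin lee_fin aM.
Qed.

Lemma partial_sumE (V : zmodType) (a : I -> V) (A : {fset I}) :
  partial_sum a A = \sum_(x <- A) a x.
Proof. by rewrite /summability.partial_sum big_seq_fsetE. Qed.

Lemma esum_cvg (a : I -> R) : (forall x, 0 <= a x) ->
  (\esum_(x in [set: I]) (a x)%:E < +oo)%E ->
  partial_sum a @ totally --> fine (\esum_(x in [set: I]) (a x)%:E).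
Proof.
move=> a0 aoo.
have fin : (\esum_(x in [set: I]) (a x)%:E)%E \is a fin_num.
  by rewrite ge0_fin_numE// esum_ge0// => x _; rewrite lee_fin.
set l := fine _.
have lE : (\esum_(x in [set: I]) (a x)%:E)%E = l%:E by rewrite fineK.
have ub (A : {fset I}) : partial_sum a A <= l.
  by rewrite partial_sumE -lee_fin -lE le_esum_uniq.
apply/cvgrPdist_le => e e0.
have [A lA] : exists A : {fset I}, l - e <= partial_sum a A.
  apply: contrapT => /forallNP noA.
  have : (\esum_(x in [set: I]) (a x)%:E <= (l - e)%:E)%E.
    apply: esum_le_uniq => s us.
    have /negP := noA [fset x in s]%fset; rewrite -ltNge partial_sumE => /ltW.
    apply: le_trans; rewrite le_eqVlt; apply/orP; left; apply/eqP.
    apply: perm_big; apply: uniq_perm => // x.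
    by rewrite inE.
  by rewrite lE lee_fin leNgt gtrBl e0.
exists A => // B /= AB.
rewrite ger0_norm ?subr_ge0//.
rewrite lerBlDr addrC -lerBlDr (le_trans lA)//.
rewrite !partial_sumE.
rewrite [leRHS](big_fsetID _ (mem A))/=.
have -> : [fset x in B | x \in A]%fset = A.
  by apply/fsetP => x; rewrite !inE/= andb_idl// => /(fsubsetP AB).
by rewrite lerDl sumr_ge0.
Qed.

Lemma cvg_complex (T : Type) (F : set_system T) (FF : Filter F)
    (f g : T -> R) (a b : R) : f @ F --> a -> g @ F --> b ->
  (fun t => (f t +i* g t)%C : R[i]^o) @ F --> ((a +i* b)%C : R[i]^o).
Proof.
move=> /cvgrPdist_lt fa /cvgrPdist_lt gb; apply/cvgrPdist_lt => -[e e'].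
rewrite ltcE/= => /andP[/eqP-> e0].
near=> t.
rewrite -[_ - _]/(((a - f t) +i* (b - g t))%C) normc_def/= ltcR.
have fe : `|a - f t| < e / 2 by near: t; apply: fa; rewrite divr_gt0.
have ge : `|b - g t| < e / 2 by near: t; apply: gb; rewrite divr_gt0.
rewrite -(@ltr_pXn2r _ 2) ?nnegrE ?sqrtr_ge0 ?ltW// sqr_sqrtr ?addr_ge0 ?sqr_ge0//.
have sq (x : R) : `|x| < e / 2 -> x ^+ 2 < e ^+ 2 / 4.
  move=> xe; rewrite -real_normK ?num_real//.
  have -> : e ^+ 2 / 4 = (e / 2) ^+ 2 by rewrite expr_div_n -natrX.
  by rewrite ltr_pXn2r ?nnegrE// ltW// divr_gt0.
apply: lt_le_trans (ltrD (sq _ fe) (sq _ ge)) _.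
rewrite -mulrDl -mulr2n -[_ *+ 2]mulr_natr -mulrA ler_piMr ?sqr_ge0//.
by rewrite ler_pdivrMr ?mul1r// ler_nat.
Unshelve. all: by end_near. Qed.

Lemma partial_sum_Re (f : I -> R[i]) A :
  complex.Re (partial_sum f A) = partial_sum (fun x => complex.Re (f x)) A.
Proof. by rewrite !partial_sumE (big_morph (@complex.Re R) (id1 := 0) (op1 := +%R))// => -[? ?] []. Qed.

Lemma partial_sum_Im (f : I -> R[i]) A :
  complex.Im (partial_sum f A) = partial_sum (fun x => complex.Im (f x)) A.
Proof. by rewrite !partial_sumE (big_morph (@complex.Im R) (id1 := 0) (op1 := +%R))// => -[? ?] []. Qed.

Lemma abs_cvg (f b : I -> R) : (forall x, `|f x| <= b x) ->
  (\esum_(x in [set: I]) (b x)%:E < +oo)%E -> cvg (partial_sum f @ totally).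
Proof.
move=> fb boo.
have b0 x : 0 <= b x by exact: le_trans (fb x).
pose p x := Num.max (f x) 0; pose n x := Num.max (- f x) 0.
have p0 x : 0 <= p x by rewrite le_max lexx orbT.
have n0 x : 0 <= n x by rewrite le_max lexx orbT.
have poo : (\esum_(x in [set: I]) (p x)%:E < +oo)%E.
  apply: le_lt_trans boo; apply: le_esum => x _; rewrite lee_fin ge_max b0 andbT.
  exact: le_trans (ler_norm _) (fb x).
have noo : (\esum_(x in [set: I]) (n x)%:E < +oo)%E.
  apply: le_lt_trans boo; apply: le_esum => x _; rewrite lee_fin ge_max b0 andbT.
  by rewrite (le_trans (ler_norm _))// normrN.
have -> : partial_sum f = (fun A => partial_sum p A - partial_sum n A).
  apply/funext => A; rewrite !partial_sumE -sumrB; apply: eq_bigr => x _.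
  rewrite /p /n; case: (leP 0 (f x)) => fx.
    by rewrite max_r ?subr0// oppr_le0.
  by rewrite max_l ?opprK ?add0r// oppr_ge0 ltW.
by apply/cvg_ex; eexists; apply: cvgB; exact: esum_cvg.
Qed.

Lemma normc_ge_ReIm (z : R[i]) :
  `|complex.Re z| <= Normc.normc z /\ `|complex.Im z| <= Normc.normc z.
Proof.
case: z => a b /=.
by split; rewrite -sqrtr_sqr ler_wsqrtr// (lerDl, lerDr) sqr_ge0.
Qed.

Lemma normc_cvg (f : I -> R[i]) (b : I -> R) :
  (forall x, Normc.normc (f x) <= b x) ->
  (\esum_(x in [set: I]) (b x)%:E < +oo)%E ->
  cvg (partial_sum (f : I -> R[i]^o) @ totally).
Proof.
move=> fb boo.
have /cvg_ex[/= r fr] : cvg (partial_sum (fun x => complex.Re (f x)) @ totally).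
  by apply: abs_cvg boo => x; exact: le_trans (normc_ge_ReIm _).1 (fb x).
have /cvg_ex[/= i fi] : cvg (partial_sum (fun x => complex.Im (f x)) @ totally).
  by apply: abs_cvg boo => x; exact: le_trans (normc_ge_ReIm _).2 (fb x).
apply/cvg_ex; exists (r +i* i)%C.
have -> : partial_sum (f : I -> R[i]^o) =
   (fun A => (partial_sum (fun x => complex.Re (f x)) A +i*
              partial_sum (fun x => complex.Im (f x)) A)%C : R[i]^o).
  apply/funext => A; rewrite -partial_sum_Re -partial_sum_Im.
  by case: (partial_sum _ _).
exact: cvg_complex.
Qed.

End sums.

Lemma normcC (R : realType) (z : R[i]) : `|z| = (Normc.normc z)%:C%C.
Proof. by case: z => a b; rewrite normc_def. Qed.

Lemma normc_ge0 (R : realType) (z : R[i]) : 0 <= Normc.normc z.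
Proof. by case: z => a b; exact: sqrtr_ge0. Qed.

Lemma normc_leD (R : realType) (z w : R[i]) :
  Normc.normc (z + w) <= Normc.normc z + Normc.normc w.
Proof. by rewrite -lecR rmorphD/= -!normcC ler_normD. Qed.

Lemma normc_sqD (R : realType) (z w : R[i]) :
  Normc.normc (z + w) ^+ 2 <= 2 * (Normc.normc z ^+ 2 + Normc.normc w ^+ 2).
Proof.
set a := Normc.normc z; set b := Normc.normc w.
have /le_trans -> // : Normc.normc (z + w) ^+ 2 <= (a + b) ^+ 2.
  by rewrite ler_pXn2r ?nnegrE ?addr_ge0 ?normc_ge0// normc_leD.
have := sqr_ge0 (a - b).
lra.
Qed.

Lemma normc_leM (R : realType) (z w : R[i]) :
  Normc.normc (z * w) <= Normc.normc z ^+ 2 + Normc.normc w ^+ 2.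
Proof.
rewrite Normc.normcM; set a := Normc.normc z; set b := Normc.normc w.
have ab : 0 <= a * b by rewrite mulr_ge0 ?normc_ge0.
by have := sqr_ge0 (a - b); lra.
Qed.

Lemma normc_conj (R : realType) (z : R[i]) : Normc.normc z^*%C = Normc.normc z.
Proof. by case: z => a b /=; rewrite sqrrN. Qed.

Lemma eqfun_cvg (T : Type) (U : nbhsType) (F : set_system T) (f g : T -> U)
  (l : U) : f =1 g -> f @ F --> l -> g @ F --> l.
Proof. by move=> /funext ->. Qed.

Section ell2_space.
Variables (R : realType) (X : Type).

(* The sum of |phi x|^2 over X is the supremum of its finite partial sums.
   {classic X} is X itself, equipped with a classical choice operator. *)
Definition sqsum (phi : X -> R[i]) : \bar R :=
  \esum_(x in [set: {classic X}]) (Normc.normc (phi x) ^+ 2)%:E.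

Definition square_summable : {pred X -> R[i]} :=
  fun phi => `[< (sqsum phi < +oo)%E >].

Record ell2 := Ell2 {
  ell2_fun :> X -> R[i];
  _ : ell2_fun \in square_summable }.

HB.instance Definition _ := [isSub for ell2_fun].
HB.instance Definition _ := [Choice of ell2 by <:].

Lemma ell2_lty (phi : ell2) : (sqsum phi < +oo)%E.
Proof. exact: (asboolW (valP phi)). Qed.

Lemma ell2_ext (phi psi : ell2) : (forall x, phi x = psi x) -> phi = psi.
Proof. by move=> e; apply: val_inj; exact/funext. Qed.

Lemma square_summableI (phi : X -> R[i]) (M : R) :
  (forall s : seq {classic X}, uniq s ->
    \sum_(x <- s) Normc.normc (phi x) ^+ 2 <= M) -> phi \in square_summable.
Proof.
move=> phiM; apply/asboolP; apply: le_lt_trans (ltry M).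
exact: esum_le_uniq.
Qed.

Lemma le_sqsum (phi : X -> R[i]) (s : seq {classic X}) :
  phi \in square_summable -> uniq s ->
  \sum_(x <- s) Normc.normc (phi x) ^+ 2 <= fine (sqsum phi).
Proof.
move=> /asboolW phioo us; rewrite -lee_fin fineK; last first.
  by rewrite ge0_fin_numE// esum_ge0// => x _; rewrite lee_fin sqr_ge0.
by apply: le_esum_uniq => // x; exact: sqr_ge0.
Qed.

Lemma square_summable_submod : submod_closed square_summable.
Proof.
split=> [|a phi psi phiP psiP].
  apply: (@square_summableI _ 0) => s _.
  by rewrite big1// => x _; rewrite Normc.normc0 expr0n.
apply: (@square_summableI _ (2 * (Normc.normc a ^+ 2 * fine (sqsum phi) +
  fine (sqsum psi)))) => s us.
apply: (@le_trans _ _ (\sum_(x <- s) (2 * (Normc.normc a ^+ 2 *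
    Normc.normc (phi x) ^+ 2 + Normc.normc (psi x) ^+ 2)))).
  apply: ler_sum => x _; apply: le_trans (normc_sqD _ _) _.
  by rewrite Normc.normcM exprMn.
rewrite -mulr_sumr ler_pM2l// big_split/= -mulr_sumr lerD// ?le_sqsum//.
by rewrite ler_wpM2l ?sqr_ge0// le_sqsum.
Qed.

HB.instance Definition _ := GRing.isSubmodClosed.Build R[i] (X -> R[i])
  square_summable square_summable_submod.

HB.instance Definition _ := [SubChoice_isSubLmodule of ell2 by <:].

(* summability.sum is the limit of the net of finite partial sums; R[i]^o is
   R[i] with its normed topology. *)
Definition ell2_inner (phi psi : ell2) : R[i] :=
  summability.sum (fun x : {classic X} => (phi x)^*%C * psi x : R[i]^o).

Lemma ell2_inner_is_cvg (phi psi : ell2) :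
  cvg (summability.partial_sum
    (fun x : {classic X} => (phi x)^*%C * psi x : R[i]^o) @ summability.totally).
Proof.
apply: (@normc_cvg _ _ _ (fun x : {classic X} =>
  Normc.normc (phi x) ^+ 2 + Normc.normc (psi x) ^+ 2)).
  by move=> x; apply: le_trans (normc_leM _ _) _; rewrite normc_conj.
under eq_esum do rewrite EFinD.
rewrite esumD; try by move=> x _; rewrite lee_fin sqr_ge0.
by rewrite lte_add_pinfty// ell2_lty.
Qed.

Lemma ell2_inner_lim (phi psi : ell2) (l : R[i]) :
  summability.partial_sum
    (fun x : {classic X} => (phi x)^*%C * psi x : R[i]^o) @ summability.totally
    --> (l : R[i]^o) -> ell2_inner phi psi = l.
Proof. by move=> h; apply: cvg_lim h; exact: norm_hausdorff. Qed.

Lemma ell2_innerDr phi psi xi :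
  ell2_inner phi (psi + xi) = ell2_inner phi psi + ell2_inner phi xi.
Proof.
apply: ell2_inner_lim.
apply: eqfun_cvg (cvgD (@ell2_inner_is_cvg phi psi) (@ell2_inner_is_cvg phi xi)) => A.
rewrite -[LHS]/(summability.partial_sum _ A + summability.partial_sum _ A).
rewrite !partial_sumE -big_split/=; apply: eq_bigr => x _ /=.
by rewrite -mulrDr.
Qed.

Lemma ell2_innerZr phi a psi :
  ell2_inner phi (a *: psi) = a * ell2_inner phi psi.
Proof.
apply: ell2_inner_lim.
apply: eqfun_cvg (cvgZl_tmp (k := a) (@ell2_inner_is_cvg phi psi)) => A /=.
rewrite !partial_sumE scaler_sumr; apply: eq_bigr => x _ /=.
by rewrite /GRing.scale/= mulrCA.
Qed.

Lemma ell2_inner_conj phi psi : ell2_inner psi phi = (ell2_inner phi psi)^*%C.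
Proof.
apply: ell2_inner_lim.
have /cvgrPdist_le h := @ell2_inner_is_cvg phi psi.
apply/cvgrPdist_le => e /h; apply: filterS => A.
rewrite -normcJ; congr (_ <= _); congr `| _ |.
rewrite [LHS]rmorphB/=; congr (_ - _).
rewrite !partial_sumE [LHS]rmorph_sum; apply: eq_bigr => x _ /=.
by rewrite rmorphM/= conjcK mulrC.
Qed.

Lemma ell2_inner_self phi : ell2_inner phi phi = (fine (sqsum phi))%:C%C.
Proof.
apply: ell2_inner_lim.
have h := @esum_cvg _ {classic X}
  (fun x => Normc.normc (phi x) ^+ 2) (fun=> sqr_ge0 _) (ell2_lty phi).
apply: eqfun_cvg (cvg_complex _ h (@cvg_cst _ 0 _ _ _)) => A /=.
rewrite !partial_sumE -[LHS]/(real_complex R _) rmorph_sum/=.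
apply: eq_bigr => x _; rewrite mulrC -sqr_normc normcC -rmorphXn//.
Qed.

Lemma ell2_inner_ge0 phi : 0 <= ell2_inner phi phi.
Proof.
rewrite ell2_inner_self ler0c fine_ge0// esum_ge0// => x _.
by rewrite lee_fin sqr_ge0.
Qed.

Lemma ell2_inner_eq0 phi : ell2_inner phi phi = 0 -> phi = 0.
Proof.
rewrite ell2_inner_self => -[phi0]; apply: ell2_ext => x.
have := @le_sqsum phi [:: x] (valP phi) isT.
rewrite phi0 big_seq1 => phix; apply: Normc.eq0_normc; apply/eqP.
by rewrite -sqrf_eq0 eq_le phix sqr_ge0.
Qed.

HB.instance Definition _ := Lmodule_isPreHilbert.Build R ell2
  ell2_innerDr ell2_innerZr ell2_inner_conj ell2_inner_ge0 ell2_inner_eq0.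

Lemma ell2_normE (phi : ell2) : `|phi| ^+ 2 = (fine (sqsum phi))%:C%C.
Proof. by rewrite -inner_norm; exact: ell2_inner_self. Qed.

Lemma ell2_norm_leP (phi : ell2) (e : R) : 0 <= e ->
  `|phi| <= e%:C%C <-> forall s : seq {classic X}, uniq s ->
    \sum_(x <- s) Normc.normc (phi x) ^+ 2 <= e ^+ 2.
Proof.
move=> e0; rewrite -(@ler_pXn2r _ 2) ?nnegrE ?ler0c// ell2_normE -rmorphXn lecR.
split=> [h s us|h]; first exact: le_trans (le_sqsum (valP phi) us) h.
rewrite -lee_fin fineK; last first.
  rewrite ge0_fin_numE ?ell2_lty// esum_ge0// => x _.
  by rewrite lee_fin sqr_ge0.
exact: esum_le_uniq.
Qed.

End ell2_space.

Section ell2_complete.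
Variables (R : realType).

Lemma normc_cvg_normc (T : Type) (F : set_system T) (FF : Filter F)
    (f : T -> R[i]) (l : R[i]) : (f : T -> R[i]^o) @ F --> (l : R[i]^o) ->
  (fun t => Normc.normc (f t)) @ F --> Normc.normc l.
Proof.
move=> /cvgrPdist_lt fl; apply/cvgrPdist_lt => e e0.
have := fl e%:C%C; rewrite ltcR => /(_ e0); apply: filterS => t.
rewrite normcC ltcR; apply: le_lt_trans.
rewrite ler_norml lerBrDr lerBlDr addrC -lerBrDr opprK addrC.
have h1 := normc_leD (l - f t) (f t).
have h2 := normc_leD (f t - l) l.
rewrite subrK in h1; rewrite subrK in h2.
have h3 : Normc.normc (f t - l) = Normc.normc (l - f t).
  by apply: (@complexI R); rewrite -!normcC distrC.
by rewrite h3 in h2; apply/andP; split; lra.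
Qed.

Lemma complex_complete (F : set_system R[i]^o) :
  ProperFilter F -> cauchy F -> exists l : R[i]^o, F --> l.
Proof.
move=> PF /cauchyP Fc.
have part (p : R[i] -> R) : (forall z w, `|p z - p w| <= Normc.normc (z - w)) ->
    cvg ((p : R[i]^o -> R) @ F).
  move=> pn; apply: cauchy_cvg; apply/cauchyP => e e0.
  have e0' : 0 < e%:C%C by rewrite ltcR.
  have [z zF] := Fc _ e0'.
  exists (p z); suff : F (fun w : R[i]^o => ball (p z) e (p w)) by [].
  apply: filterS zF => w; rewrite -!ball_normE => zw.
  have {}zw : `|z - w| < e%:C%C := zw.
  rewrite normcC ltcR in zw.
  by apply: le_lt_trans zw; exact: pn.
have /cvg_ex[a aP] := part (@complex.Re R) 
  ltac:(by move=> z w; have := (normc_ge_ReIm (z - w)).1; case: z w => ? ? []).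
have /cvg_ex[b bP] := part (@complex.Im R) 
  ltac:(by move=> z w; have := (normc_ge_ReIm (z - w)).2; case: z w => ? ? []).
exists (a +i* b)%C.
have h := cvg_complex _ aP bP.
move=> A /h hA.
suff -> : A = (fun t : R[i] => (complex.Re t +i* complex.Im t)%C) @^-1` A by [].
by apply/funext => -[? ?].
Qed.

Variable X : Type.

Lemma ell2_eval_lt (phi : ell2 R X) (x : X) (e : R) : 0 < e ->
  `|phi| <= e%:C%C -> Normc.normc (phi x) <= e.
Proof.
move=> e0 /(ell2_norm_leP _ (ltW e0))/(_ [:: x] isT); rewrite big_seq1.
by rewrite ler_pXn2r ?nnegrE ?normc_ge0// ltW.
Qed.

Lemma ell2_completeP (F : set_system (ell2 R X)) :
  ProperFilter F -> cauchy F -> cvg F.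
Proof.
move=> PF /cauchyP Fc.
have /choice[g gP] x : exists l : R[i]^o, (fun phi : ell2 R X => phi x : R[i]^o) @ F --> l.
  apply: complex_complete; apply/cauchyP => -[e e'].
  rewrite ltcE/= => /andP[/eqP-> e0].
  have e0' : 0 < e%:C%C by rewrite ltcR.
  have e2 : 0 < (e / 2)%:C%C by rewrite ltcR divr_gt0.
  have [phi phiF] := Fc _ e2; exists (phi x).
  suff : F (fun psi : ell2 R X => ball (phi x : R[i]^o) e%:C%C (psi x)) by [].
  apply: filterS phiF => psi; rewrite -!ball_normE => psiP.
  have h : `|phi - psi| <= (e / 2)%:C%C := ltW psiP.
  suff : `|phi x - psi x| < e%:C%C by [].
  rewrite normcC ltcR.
  apply: (@le_lt_trans _ _ (e / 2)); last by rewrite ltr_pdivrMr// ltr_pMr// ltr1n.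
  by apply: (@ell2_eval_lt (phi - psi)) h; rewrite divr_gt0.
have key (e : R) : 0 < e -> exists2 A, F A & forall phi : ell2 R X, A phi ->
    forall s : seq {classic X}, uniq s ->
      \sum_(x <- s) Normc.normc (phi x - g x) ^+ 2 <= e ^+ 2.
  move=> e0; have e2 : 0 < (e / 2)%:C%C by rewrite ltcR divr_gt0.
  have [phi0 phi0F] := Fc _ e2; eexists; first exact: phi0F.
  move=> phi phi0phi s us.
  have lims : (fun psi : ell2 R X =>
      \sum_(x <- s) Normc.normc (phi x - psi x) ^+ 2) @ F -->
      \sum_(x <- s) Normc.normc (phi x - g x) ^+ 2.
    elim: s {us} => [|x s IH].
      rewrite big_nil; apply: eqfun_cvg (cvg_cst 0) => psi.
      by rewrite big_nil.
    rewrite big_cons.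
    have h : (fun psi : ell2 R X => Normc.normc (phi x - psi x) ^+ 2) @ F -->
        Normc.normc (phi x - g x) ^+ 2.
      rewrite expr2; apply: eqfun_cvg (cvgM (normc_cvg_normc _ _)
        (normc_cvg_normc _ _)); first by move=> psi; rewrite expr2.
      + by apply: cvgB (gP x); exact: cvg_cst.
      + by apply: cvgB (gP x); exact: cvg_cst.
    by apply: eqfun_cvg (cvgD h IH) => psi; rewrite big_cons.
  rewrite -(cvg_lim _ lims)//; apply: limr_le; first by apply/cvg_ex; eexists; exact: lims.
  apply: filterS phi0F => psi.
  move: phi0phi; rewrite -!ball_normE/= => phi0phi phi0psi.
  apply: ((ell2_norm_leP (phi - psi) (ltW e0)).1 _ s us).
  rewrite -(subrKA phi0); apply: le_trans (ler_normD _ _) _.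
  rewrite [e]splitr rmorphD/= lerD// ltW// distrC //.
have gss : (g : X -> R[i]) \in @square_summable R X.
  have [A FA AP] := key 1 ltr01.
  have [phi Aphi] := filter_ex FA.
  have hP : (fun x => phi x - g x) \in @square_summable R X.
    by apply: square_summableI => s; exact: AP.
  have -> : (g : X -> R[i]) = (phi : X -> R[i]) - (fun x => phi x - g x).
    by apply/funext => x; rewrite fctE opprB addrC subrK.
  by rewrite rpredB// (valP phi).
apply/cvg_ex; exists (Ell2 gss); apply/cvgrPdist_le => -[e e'].
rewrite ltcE/= => /andP[/eqP-> e0].
have [A FA AP] := key e e0.
apply: filterS FA => phi Aphi; rewrite distrC.
by apply/(ell2_norm_leP _ (ltW e0)) => s us; exact: AP.
Qed.

HB.instance Definition _ := Uniform_isComplete.Build (ell2 R X) ell2_completeP.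

End ell2_complete.


Section ell2_map.
Variables (R : realType) (X Y : Type) (f : pinj X Y).

Definition ell2_push (phi : X -> R[i]) (y : Y) : R[i] :=
  if pselect (exists x, f x y) is left fy then phi (sval (cid fy)) else 0.

Lemma ell2_pushE phi x y : f x y -> ell2_push phi y = phi x.
Proof.
rewrite /ell2_push => fxy; case: pselect => [fy|[]]; last by exists x.
by congr phi; exact: pinj_inj (svalP (cid fy)) fxy.
Qed.

Lemma ell2_push0 phi y : ~ (exists x, f x y) -> ell2_push phi y = 0.
Proof. by rewrite /ell2_push; case: pselect. Qed.

Lemma ell2_push_le (phi : X -> R[i]) (s : seq {classic Y}) (M : R) :
  (forall t : seq {classic X}, uniq t ->
    \sum_(x <- t) Normc.normc (phi x) ^+ 2 <= M) ->
  uniq s -> \sum_(y <- s) Normc.normc (ell2_push phi y) ^+ 2 <= M.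
Proof.
move=> phiM us.
suff [t [ut tE _]] : exists t : seq {classic X}, [/\ uniq t,
    \sum_(y <- s) Normc.normc (ell2_push phi y) ^+ 2 =
    \sum_(x <- t) Normc.normc (phi x) ^+ 2 &
    forall x, x \in t -> exists2 y : {classic Y}, y \in s & f x y].
  by rewrite tE phiM.
elim: s us => [_|y s IH /= /andP[ys us]].
  by exists [::]; rewrite !big_nil; split.
have [t [ut tE ts]] := IH us.
have [[x fxy]|ny] := pselect (exists x, f x y).
  exists (x :: t); split=> /=.
  - rewrite ut andbT; apply/negP => /ts[y' y's fxy'].
    by move: ys; rewrite (pinj_fun fxy fxy') y's.
  - by rewrite !big_cons tE (ell2_pushE _ fxy).
  - move=> x'; rewrite inE => /predU1P[->|/ts[y' y's fxy']].
      by exists y => //; rewrite inE eqxx.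
    by exists y' => //; rewrite inE y's orbT.
exists t; split => //.
  by rewrite big_cons ell2_push0// Normc.normc0 expr0n add0r.
by move=> x /ts[y' y's fxy']; exists y' => //; rewrite inE y's orbT.
Qed.

Lemma ell2_push_summable (phi : ell2 R X) :
  ell2_push phi \in @square_summable R Y.
Proof.
apply: square_summableI => s; apply: ell2_push_le => t.
exact: le_sqsum (valP phi).
Qed.

Definition ell2_map_fun (phi : ell2 R X) : ell2 R Y :=
  Ell2 (ell2_push_summable phi).

Lemma ell2_map_linear : linear ell2_map_fun.
Proof.
move=> a phi psi; apply: ell2_ext => y.
rewrite -[RHS]/(a * ell2_push phi y + ell2_push psi y) -[LHS]/(ell2_push _ y).
have [[x fxy]|ny] := pselect (exists x, f x y).
  by rewrite !(ell2_pushE _ fxy).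
by rewrite !ell2_push0// mulr0 addr0.
Qed.

HB.instance Definition _ :=
  GRing.isLinear.Build R[i] (ell2 R X) (ell2 R Y) _ ell2_map_fun ell2_map_linear.

Lemma ell2_map_contraction (phi : ell2 R X) : `|ell2_map_fun phi| <= `|phi|.
Proof.
have nE : `|phi| = (Normc.normc `|phi|)%:C%C by rewrite -normcC normr_id.
rewrite nE; apply/(ell2_norm_leP _ (normc_ge0 _)) => s; apply: ell2_push_le.
by apply/(ell2_norm_leP _ (normc_ge0 _)); rewrite -nE.
Qed.

Lemma ell2_map_continuous : continuous ell2_map_fun.
Proof.
apply: (@bounded_linear_continuous _ _ _ ell2_map_fun); apply/linear_boundedP.
near=> r => phi; apply: le_trans (ell2_map_contraction phi) _.
by rewrite ler_peMl//; near: r; exact: nbhs_pinfty_ge.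
Unshelve. all: by end_near. Qed.

Definition ell2_map : clinear (ell2 R X) (ell2 R Y) :=
  @ContinuousLinear R (ell2 R X) (ell2 R Y) ell2_map_fun ell2_map_continuous.

End ell2_map.

Section ell2_functor.
Variable R : realType.

Lemma ell2_map1 (X : Type) :
  ell2_map R (pinj_id X) = clinear_id (ell2 R X).
Proof.
by apply: clinear_ext => phi; apply: ell2_ext => x; exact: ell2_pushE.
Qed.

Lemma ell2_mapM (X Y Z : Type) (g : pinj Y Z) (f : pinj X Y) :
  ell2_map R (pinj_comp g f) = clinear_comp (ell2_map R g) (ell2_map R f).
Proof.
apply: clinear_ext => phi; apply: ell2_ext => z.
rewrite -[LHS]/(ell2_push (pinj_comp g f) phi z).
rewrite -[RHS]/(ell2_push g (ell2_push f phi) z).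
have [[y gyz]|nz] := pselect (exists y, g y z); last first.
  by rewrite !ell2_push0// => -[x [y [_ gyz]]]; apply: nz; exists y.
rewrite (ell2_pushE _ gyz).
have [[x fxy]|ny] := pselect (exists x, f x y).
  by rewrite (ell2_pushE _ fxy) (@ell2_pushE _ _ _ _ _ x)//; exists y.
rewrite !ell2_push0// => -[x [y' [fxy' gy'z]]]; apply: ny; exists x.
by rewrite (pinj_inj gyz gy'z).
Qed.

Definition ell2_functor : functor PInj (Hilb R) :=
  @Functor PInj (Hilb R) (fun X => ell2 R X) (@ell2_map R)
    ell2_map1 ell2_mapM.

End ell2_functor.

(* Main.v *)
Require Import Defs.
From HB Require Import structures.
From mathcomp Require Import all_boot all_order all_algebra complex finmap.
From mathcomp Require Import all_classical all_reals all_analysis.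
From mathcomp Require summability.

(** Everything except essential surjectivity is read off the basis vectors
    delta_x of ell2(X).  The coordinate at y of the image of delta_x under
    ell2(f) is nonzero exactly when f relates x to y ([ell2_push_basis]), so
    ell2(f) determines f.  If ell2(f) is invertible, it cannot kill any delta_x,
    so f is defined everywhere, and some vector is mapped to delta_y for
    every y, so f is onto; a total and surjective partial injection has its
    converse relation as inverse.  The functor is not full because the image of
    delta_x only has coordinates 0 and 1, whereas minus the identity of the line
    ell2(1) has coordinate -1.

    Essential surjectivity is the existence of orthonormal bases together with
    the Riesz-Fischer theorem.  By Zorn's lemma a Hilbert space H has a maximal
    orthonormal subset B, and maximality forces every vector orthogonal to B to
    vanish ([orthonormal_basis]).  Bessel's inequality ([bessel]) says that the
    family of coefficients of a vector along B lies in ell2(B), and that taking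
    coefficients is a contraction ([coords]).  Conversely, for phi in ell2(B) the
    finite sums of the vectors phi(b) b form a Cauchy net, because their
    distances are tails of the convergent sum of the |phi(b)|^2
    ([series_cvg]); completeness of H gives a limit, [synthesis], whose
    coefficients are phi ([coordsK]).  Maximality of B makes [coords] injective,
    so this right inverse is two-sided and automatically linear, and it is a
    contraction by Pythagoras.  Hence H is isomorphic to ell2(B). *)

Set Implicit Arguments.
Unset Strict Implicit.
Unset Printing Implicit Defensive.

Import Order.TTheory GRing.Theory Num.Theory numFieldNormedType.Exports.

Local Open Scope classical_set_scope.
Local Open Scope ring_scope.

Local Notation partial_sum := summability.partial_sum.
Local Notation totally := summability.totally.

(** * Inner products *)

Section inner_product.
Variables (R : realType) (H : hilbertType R).
Implicit Types u v w : H.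

Lemma inner_is_linear u : linear_for *%R (inner u).
Proof. by move=> a v w; rewrite innerDr innerZr. Qed.

HB.instance Definition _ u :=
  GRing.isLinear.Build R[i] H R[i] *%R (inner u) (inner_is_linear u).

Lemma innerDl u v w : inner (u + v) w = inner u w + inner v w.
Proof. by rewrite (inner_conj w (u + v)) linearD rmorphD/= -!inner_conj. Qed.

Lemma innerZl a u v : inner (a *: u) v = a^*%C * inner u v.
Proof. by rewrite (inner_conj v (a *: u)) linearZ rmorphM/= -inner_conj. Qed.

Lemma inner_suml (I : Type) (s : seq I) (F : I -> H) v :
  inner (\sum_(x <- s) F x) v = \sum_(x <- s) inner (F x) v.
Proof.
rewrite inner_conj linear_sum rmorph_sum; apply: eq_bigr => x _.
by rewrite /= -inner_conj.
Qed.

Lemma conjM_normc (z : R[i]) : z^*%C * z = (Normc.normc z ^+ 2)%:C%C.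
Proof. by rewrite mulrC -sqr_normc normcC rmorphXn. Qed.

Lemma pythagoras u v : inner u v = 0 -> `|u + v| ^+ 2 = `|u| ^+ 2 + `|v| ^+ 2.
Proof.
move=> uv; rewrite -!inner_norm innerDl !linearD/= uv addr0.
by rewrite (inner_conj u v) uv rmorph0 add0r.
Qed.

End inner_product.

(** Norms take values in R[i]; this exposes them as real numbers, for which
    square roots, suprema and epsilon arguments are available. *)
Lemma real_norm (R : realType) (V : normedModType R[i]) (v : V) :
  `|v| = (Normc.normc `|v|)%:C%C.
Proof. by rewrite -normcC normr_id. Qed.

Lemma contraction_continuous (R : realType) (V W : normedModType R[i])
  (f : {linear V -> W}) : (forall v, `|f v| <= `|v|) -> continuous f.
Proof.
move=> f1; apply: bounded_linear_continuous; apply/linear_boundedP.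
near=> r => v; apply: le_trans (f1 v) _.
by rewrite ler_peMl//; near: r; exact: nbhs_pinfty_ge.
Unshelve. all: by end_near. Qed.

Lemma partial_sumB (I : choiceType) (V : zmodType) (a : I -> V)
  (A B : {fset I}) : (A `<=` B)%fset ->
  partial_sum a B - partial_sum a A = partial_sum a (B `\` A)%fset.
Proof.
move=> AB; rewrite !partial_sumE (big_fsetID _ (mem A))/=.
have -> : [fset x in B | x \in A]%fset = A.
  by apply/fsetP => x; rewrite !inE/= andb_idl// => /(fsubsetP AB).
have -> : [fset x in B | x \notin A]%fset = (B `\` A)%fset.
  by apply/fsetP => x; rewrite !inE/= andbC.
by rewrite [X in X - _]addrC addrK.
Qed.

(** * Coordinates along an orthonormal family *)

Section orthonormal.
Variables (R : realType) (H : hilbertType R) (X : Type) (e : X -> H).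
Implicit Types (s : seq {classic X}) (phi : X -> R[i]).

Definition orthonormal :=
  forall x y : {classic X}, inner (e x) (e y) = (x == y)%:R.

Hypothesis orthonormal_e : orthonormal.

Lemma inner_combination phi s x : uniq s ->
  inner (e x) (\sum_(y <- s) phi y *: e y) =
  (if (x : {classic X}) \in s then phi x else 0).
Proof.
move=> us; rewrite linear_sum/=; case: ifPn => xs.
  rewrite (bigD1_seq (x : {classic X}))//= linearZ/= orthonormal_e eqxx mulr1.
  rewrite big1 ?addr0// => y yx.
  by rewrite linearZ/= orthonormal_e eq_sym (negbTE yx) mulr0.
rewrite big_seq big1// => y ys; rewrite linearZ/= orthonormal_e.
by case: eqVneq xs => [->|_ _]; rewrite ?ys ?mulr0.
Qed.

Lemma normsq_combination phi s : uniq s ->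
  `|\sum_(y <- s) phi y *: e y| ^+ 2 =
  (\sum_(y <- s) Normc.normc (phi y) ^+ 2)%:C%C.
Proof.
move=> us; rewrite -inner_norm inner_suml.
rewrite -[RHS]/(real_complex R _) rmorph_sum/= [LHS]big_seq [RHS]big_seq.
apply: eq_bigr => y ys; rewrite innerZl inner_combination// ys.
exact: conjM_normc.
Qed.

(** The combination p of the e x with the coefficients of v is the orthogonal
    projection of v, and p is orthogonal to v - p; so |p| <= |v|. *)
Lemma bessel s (v : H) : uniq s ->
  (\sum_(x <- s) Normc.normc (inner (e x) v) ^+ 2)%:C%C <= `|v| ^+ 2.
Proof.
move=> us; pose p := \sum_(x <- s) inner (e x) v *: e x.
rewrite -(normsq_combination (fun x => inner (e x) v) us) -/p.
have pv : inner p (v - p) = 0.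
  rewrite linearB/= {1 3}/p !inner_suml -sumrB big_seq big1// => x xs.
  by rewrite !innerZl inner_combination// xs subrr.
by rewrite -[v in leRHS](subrKC p) pythagoras// lerDl exprn_ge0.
Qed.

(** Bessel's inequality for one vector; it makes coefficients continuous. *)
Lemma coord_le (v : H) x : `|inner (e x) v| <= `|v|.
Proof.
rewrite -(@ler_pXn2r _ 2) ?nnegrE//.
have := @bessel [:: x] v isT.
by rewrite big_seq1 rmorphXn/= -normcC.
Qed.

Lemma coords_summable (v : H) :
  (fun x => inner (e x) v) \in @square_summable R X.
Proof.
apply: (@square_summableI _ _ _ (Normc.normc `|v| ^+ 2)) => s us.
by rewrite -lecR [leRHS]rmorphXn/= -real_norm bessel.
Qed.

Definition coords (v : H) : ell2 R X := Ell2 (coords_summable v).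

Lemma coords_linear : linear coords.
Proof. by move=> a u v; apply: ell2_ext => x; exact: inner_is_linear. Qed.

HB.instance Definition _ :=
  GRing.isLinear.Build R[i] H (ell2 R X) _ coords coords_linear.

Lemma coords_contraction (v : H) : `|coords v| <= `|v|.
Proof.
rewrite [leRHS]real_norm; apply/(ell2_norm_leP _ (normc_ge0 _)) => s us.
by rewrite -lecR [leRHS]rmorphXn/= -real_norm; exact: bessel.
Qed.

Lemma combination_le (phi : ell2 R X) s : uniq s ->
  `|\sum_(x <- s) phi x *: e x| <= `|phi|.
Proof.
move=> us; rewrite -(@ler_pXn2r _ 2) ?nnegrE// normsq_combination//.
by rewrite ell2_normE lecR; exact: le_sqsum (valP phi) us.
Qed.

(** Once a finite set A carries all but d^2 of the sum of the |phi x|^2, any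
    larger finite sum differs from the one over A by a vector of norm less than
    d, by Pythagoras. *)
Lemma series_cvg (phi : ell2 R X) :
  cvg (partial_sum (fun x : {classic X} => phi x *: e x) @ totally).
Proof.
apply: cauchy_cvg; apply/cauchyP => -[d d'].
rewrite ltcE/= => /andP[/eqP-> d0].
have := @esum_cvg _ {classic X}
  (fun x => Normc.normc (phi x) ^+ 2) (fun=> sqr_ge0 _) (ell2_lty phi).
move=> /cvgrPdist_lt/(_ (d ^+ 2) (exprn_gt0 2 d0))[A _ AP].
exists (partial_sum (fun x : {classic X} => phi x *: e x) A).
exists A => // B AB.
rewrite /= -ball_normE/= distrC partial_sumB//.
rewrite -(@ltr_pXn2r _ 2) ?nnegrE ?normr_ge0 ?ler0c ?(ltW d0)//.
rewrite partial_sumE (normsq_combination _ (fset_uniq _)).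
rewrite -[X in _ < X ^+ 2]/(real_complex R d) -rmorphXn ltcR -partial_sumE.
rewrite -partial_sumB//; apply: le_lt_trans (AP A (fsubset_refl A)).
apply: le_trans (ler_norm _); rewrite lerD2r partial_sumE.
exact: le_sqsum (valP phi) (fset_uniq _).
Qed.

Definition synthesis (phi : ell2 R X) : H :=
  summability.sum (fun x : {classic X} => phi x *: e x).

(** Coefficients are continuous, and the coefficient at x of a finite sum is
    phi x as soon as the sum includes the index x. *)
Lemma coordsK (phi : ell2 R X) : coords (synthesis phi) = phi.
Proof.
apply: ell2_ext => x.
pose p A := inner (e x) (partial_sum (fun y : {classic X} => phi y *: e y) A).
apply: (@cvg_unique R[i]^o (@norm_hausdorff _ _) (p @ totally)).
- apply/cvgrPdist_lt => d d0.
  have /cvgrPdist_lt/(_ _ d0) := @series_cvg phi.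
  apply: filterS => A; apply: le_lt_trans.
  by rewrite -[_ - _]linearB/=; exact: coord_le.
- apply: cvg_near_cst; exists [fset (x : {classic X})]%fset => // A /= xA.
  by rewrite /p partial_sumE (inner_combination _ _ (fset_uniq _)) -fsub1set xA.
Qed.

(** The bound holds for all finite sums ([combination_le]), hence for their
    limit. *)
Lemma synthesis_contraction (phi : ell2 R X) : `|synthesis phi| <= `|phi|.
Proof.
rewrite real_norm [leRHS]real_norm lecR; apply/ler_addgt0Pl => d d0.
have d0' : 0 < d%:C%C by rewrite ltcR.
have /cvgrPdist_lt/(_ _ d0')[A _ AP] := @series_cvg phi.
rewrite -lecR rmorphD/= -!real_norm.
rewrite -(subrK (partial_sum (fun y : {classic X} => phi y *: e y) A) (synthesis phi)).
apply: le_trans (ler_normD _ _) _; apply: lerD.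
  exact: ltW (AP A (fsubset_refl A)).
by rewrite partial_sumE; exact: combination_le (fset_uniq _).
Qed.

Hypothesis complete_e : forall v : H, (forall x, inner (e x) v = 0) -> v = 0.

Lemma coords_inj : injective coords.
Proof.
move=> u v uv; apply/eqP; rewrite -subr_eq0; apply/eqP/complete_e => x.
by rewrite linearB/= -[inner _ u]/(coords u x) uv subrr.
Qed.

Lemma synthesisK (v : H) : synthesis (coords v) = v.
Proof. by apply: coords_inj; rewrite coordsK. Qed.

(** An injective linear map has at most one right inverse, and it is linear; no
    limits are needed. *)
Lemma synthesis_linear : linear synthesis.
Proof. by move=> a u v; apply: coords_inj; rewrite coords_linear !coordsK. Qed.

HB.instance Definition _ :=
  GRing.isLinear.Build R[i] (ell2 R X) H _ synthesis synthesis_linear.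

Lemma isomorphic_ell2 : @isomorphic (Hilb R) H (ell2 R X).
Proof.
exists (@ContinuousLinear R H (ell2 R X) coords
  (contraction_continuous (f := coords) coords_contraction)).
exists (@ContinuousLinear R (ell2 R X) H synthesis
  (contraction_continuous (f := synthesis) synthesis_contraction)).
split; apply: clinear_ext => v.
  exact: synthesisK.
exact: coordsK.
Qed.

End orthonormal.

(** * Existence of orthonormal bases *)

(** A maximal orthonormal set B works: if v <> 0 were orthogonal to B, adding
    the unit vector w = v / |v| would enlarge B. *)
Lemma orthonormal_basis (R : realType) (H : hilbertType R) :
  exists B : set H, orthonormal (fun b : B => val b) /\
    forall v : H, (forall b : B, inner (val b) v = 0) -> v = 0.
Proof.
pose P (B : set H) := forall u v, B u -> B v -> inner u v = (u == v)%:R.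
(* Orthonormality concerns two vectors at a time, so it passes to unions of
   chains. *)
have [F FP Ftot|B [PB maxB]] := @Zorn_bigcup H P.
  move=> u v [A FA Au] [C FC Cv].
  have [AC|CA] := Ftot _ _ FA FC.
    by apply: (FP C) => //; exact: AC.
  by apply: (FP A) => //; exact: CA.
exists B; split=> [b c|v vB].
  rewrite PB; [|exact: set_valP|exact: set_valP].
  by congr (nat_of_bool _)%:R; apply/eqP/eqP => [/val_inj|->].
apply/eqP/negP => /negP v0.
have nv0 : `|v| != 0 by rewrite normr_eq0.
pose w := `|v|^-1 *: v.
have Bw u : B u -> inner u w = 0.
  move=> Bu; rewrite linearZ/= (vB (exist _ u (mem_set Bu))) ?mulr0//.
have ww : inner w w = 1.
  by rewrite inner_norm normrZ normfV normr_id mulVf ?expr1n.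
apply: (maxB (B `|` [set w])).
  split=> [u Bu|/(_ w (or_intror erefl))/Bw]; first by left.
  by rewrite ww => /eqP; rewrite oner_eq0.
have wB u : B u -> (u == w) = false.
  move=> Bu; apply/eqP => uw; have := Bw _ Bu.
  by rewrite uw ww => /eqP; rewrite oner_eq0.
move=> u u' [Bu|->] [Bu'|->].
- exact: PB.
- by rewrite Bw// wB.
- by rewrite inner_conj Bw// rmorph0 eq_sym wB.
- by rewrite ww eqxx.
Qed.

(** * Basis vectors of the sequence spaces *)

Section basis_vector.
Variables (R : realType) (X : Type).

Definition kronecker (x y : X) : R[i] := ((x : {classic X}) == y)%:R.

Lemma kronecker_summable x : kronecker x \in @square_summable R X.
Proof.
apply: (@square_summableI _ _ _ 1) => s us.
have [xs|xs] := boolP ((x : {classic X}) \in s).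
  rewrite (bigD1_seq (x : {classic X}))//= big1 => [|y yx].
    by rewrite /kronecker eqxx Normc.normc1 expr1n addr0.
  by rewrite /kronecker eq_sym (negbTE yx) Normc.normc0 expr0n.
rewrite big_seq big1 ?ler01// => y ys.
rewrite /kronecker; case: eqVneq ys xs => [<- ->//|_ _ _].
by rewrite Normc.normc0 expr0n.
Qed.

Definition basis_vector x : ell2 R X := Ell2 (kronecker_summable x).

Lemma basis_vector_self x : basis_vector x x = 1.
Proof. by rewrite /= /kronecker eqxx. Qed.

(** A partial injection is recovered from its action on basis vectors. *)
Lemma ell2_push_basis (Y : Type) (f : pinj X Y) x y :
  ell2_push f (basis_vector x) y != 0 <-> f x y.
Proof.
split=> [|fxy]; last by rewrite (ell2_pushE _ fxy) basis_vector_self oner_eq0.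
have [[x' fx'y]|ny] := pselect (exists x', f x' y); last first.
  by rewrite ell2_push0// eqxx.
rewrite (ell2_pushE _ fx'y) /= /kronecker.
by case: (eqVneq (x : {classic X}) x') => [->//|_]; rewrite eqxx.
Qed.

End basis_vector.

(** * Properties of the functor *)

Section properties.
Variable R : realType.

Lemma ell2_faithful : is_faithful (ell2_functor R).
Proof.
move=> X Y f g fg; apply: pinj_ext => x y.
rewrite -!(ell2_push_basis R).
have /= fgx := congr1 (fun h : clinear (ell2 R X) (ell2 R Y) =>
  ell2_fun (h (basis_vector R x))) fg.
by rewrite fgx.
Qed.

Lemma ell2_essentially_surjective : essentially_surjective (ell2_functor R).
Proof.
move=> H; have [B [orthB complB]] := @orthonormal_basis R H.
by exists (set_type B); exact: isomorphic_ell2 orthB complB.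
Qed.

(** Minus the identity on the one-point space is not induced: a partial
    injection sends the basis vector to itself or to 0. *)
Lemma ell2_not_full : ~ is_full (ell2_functor R).
Proof.
move=> full.
have oppC : continuous (\- (@idfun (ell2 R unit))).
  by apply: contraction_continuous => v; rewrite normrN.
have [f fE] := full unit unit (@ContinuousLinear R (ell2 R unit) (ell2 R unit)
  (\- (@idfun (ell2 R unit))) oppC).
have : ell2_push f (basis_vector R tt) tt = - 1.
  have := congr1 (fun h : clinear (ell2 R unit) (ell2 R unit) =>
    ell2_fun (h (basis_vector R tt)) tt) fE.
  move=> fE1; apply: etrans fE1 _.
  by congr (- _); exact: basis_vector_self.
have [ftt|nf] := pselect (f tt tt).
  rewrite (ell2_pushE _ ftt) basis_vector_self => /eqP.
  by rewrite -addr_eq0 -[1 + 1]/(2%:R) pnatr_eq0.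
rewrite ell2_push0 => [/eqP|[[]]//].
by rewrite eq_sym oppr_eq0 oner_eq0.
Qed.

(** If f were undefined at x, the injective map ell2(f) would kill the basis
    vector at x; if y were not a value of f, the image of the surjective map
    ell2(f) would consist of vectors vanishing at y. *)
Lemma ell2_reflects_isomorphisms : reflects_isomorphisms (ell2_functor R).
Proof.
move=> X Y f [g [gf fg]].
have total x : exists y, f x y.
  apply: contrapT => nx.
  have f0 : ell2_map_fun f (basis_vector R x) = 0.
    apply: ell2_ext => y; apply/eqP/negPn/negP => /ell2_push_basis fxy.
    by apply: nx; exists y.
  have := congr1 (fun h : clinear (ell2 R X) (ell2 R X) =>
    ell2_fun (h (basis_vector R x)) x) gf.
  rewrite /= f0 linear0 => /eqP.
  by rewrite -[X in _ == X]/(basis_vector R x x) basis_vector_self eq_sym oner_eq0.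
have surj y : exists x, f x y.
  apply: contrapT => ny.
  have := congr1 (fun h : clinear (ell2 R Y) (ell2 R Y) =>
    ell2_fun (h (basis_vector R y)) y) fg.
  rewrite /= ell2_push0// => /eqP.
  by rewrite -[X in _ == X]/(basis_vector R y y) basis_vector_self eq_sym oner_eq0.
exists (@PInjection Y X (fun y x => f x y)
  (fun y x x' => @pinj_inj _ _ f x x' y) (fun y y' x => @pinj_fun _ _ f x y y')).
split; apply: pinj_ext => x x' /=; split.
- by move=> [y [fxy fx'y]]; exact: pinj_inj fxy fx'y.
- by move=> <-; have [y fxy] := total x; exists y.
- by move=> [y [fyx fyx']]; exact: pinj_fun fyx fyx'.
- by move=> <-; have [y fyx] := surj x; exists y.
Qed.

End properties.

Theorem mainTheorem11 (R : realType) :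
  is_faithful (ell2_functor R) /\
  essentially_surjective (ell2_functor R) /\
  ~ is_full (ell2_functor R) /\
  reflects_isomorphisms (ell2_functor R).
Proof.
split; first exact: ell2_faithful.
split; first exact: ell2_essentially_surjective.
split; first exact: ell2_not_full.
exact: ell2_reflects_isomorphisms.
Qed.
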